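(* Let $X$ be a Banach space and $u\in C^1([0,T];X)$. Then for every $\beta\in(0,1)$, \[ \frac{1}{\Gamma(1-\beta)}\,\frac{\mathrm{d}}{\mathrm{d}t}\int_0^t (t-s)^{-\beta}\,u(s)\,\mathrm{d}s=\partial_t^\beta u(t)+\frac{t^{-\beta}}{\Gamma(1-\beta)}\,u(0). \] In particular, the once-differentiated power-law memory functional with the kernel $K(t)\sim C_\beta\,t^{-\beta}$ ($t\to\infty$), $C_\beta=\frac{2c}{\pi}\Gamma(\beta)\cos\frac{\pi\beta}{2}$, acting on a history that starts from rest, $u(0)=0$, coincides exactly with the Caputo derivative $\partial_t^\beta u$.
   Context: For $\beta\in(0,1)$ the Caputo derivative of $u\in C^1([0,T];X)$ is $\partial_t^\beta u(t)=\frac{1}{\Gamma(1-\beta)}\int_0^t(t-s)^{-\beta}u'(s)\,\mathrm{d}s$. The kernel $K$ is the memory kernel of a bath of harmonic oscillators with spectral density $J$, namely $K(t)=\frac{2}{\pi}\int_0^\infty\frac{J(\omega)}{\omega}\cos(\omega t)\,\mathrm{d}\omega$, where the bath is scale-free: $J(\omega)\sim c\,\omega^\beta$ as $\omega\to0$, with $c$ a constant; this gives $K(t)\sim C_\beta t^{-\beta}$ as $t\to\infty$ with the stated $C_\beta$. The memory functional with kernel $K$ is the convolution $\int_0^tK(t-s)u(s)\,\mathrm{d}s$, and ''once-differentiated'' means differentiated once in $t$.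
   Formalization: The ''in particular'' is proved for the exact power-law kernel equivalent to K (c nonzero, 0<t≤T), with the differentiated functional divided by C_β Γ(1−β); read literally it fails, e.g. β=1/2, c=1, K=C_β t^{-1/2}, u(t)=t gives a factor √2. *)

(* Defs.v *)
From Stdlib Require Import Reals.
From Coquelicot Require Import Coquelicot.
Open Scope R_scope.

Definition Gamma (z : R) : R :=
  RInt_gen (fun x => Rpower x (z - 1) * exp (- x))
           (at_right 0) (Rbar_locally p_infty).

(* One-sided at the end points of a segment D; only the values of f on D
   matter. *)
Definition is_derive_within {X : NormedModule R_AbsRing}
    (D : R -> Prop) (f : R -> X) (t : R) (l : X) : Prop :=
  filterdiff f (within D (locally t)) (fun h : R => scal h l).

Definition segment (T t : R) : Prop := 0 <= t <= T.

(* u is in C^1([0,T];X) and du is its derivative on [0,T]. *)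
Definition is_C1 {X : NormedModule R_AbsRing}
    (T : R) (u du : R -> X) : Prop :=
  (forall t, segment T t -> is_derive_within (segment T) u t (du t)) /\
  continuous_on (segment T) du.

(* Kernels may be singular at 0, so the integral over [0,t] is improper at t:
   the limit of the X-valued Riemann integrals over [0,b] as b -> t^-.
   For t^(-beta) with 0 < beta < 1 and continuous u it converges absolutely
   and is the Bochner integral. *)
Definition ex_memory {X : CompleteNormedModule R_AbsRing}
    (k : R -> R) (u : R -> X) (t : R) : Prop :=
  ex_RInt_gen (fun s => scal (k (t - s)) (u s)) (at_point 0) (at_left t).

Definition memory {X : CompleteNormedModule R_AbsRing}
    (k : R -> R) (u : R -> X) (t : R) : X :=
  RInt_gen (fun s => scal (k (t - s)) (u s)) (at_point 0) (at_left t).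

Definition power_kernel (beta t : R) : R := Rpower t (- beta).

(* Takes the derivative du of u as argument, see is_C1. *)
Definition caputo {X : CompleteNormedModule R_AbsRing}
    (beta : R) (du : R -> X) (t : R) : X :=
  scal (/ Gamma (1 - beta)) (memory (power_kernel beta) du t).

(* K(t) = (2/pi) int_0^oo J(w)/w cos(w t) dw.  Restricted to t > 0: for
   J(w) = c w^beta the integral diverges at t = 0. *)
Definition is_bath_kernel (J K : R -> R) : Prop :=
  forall t, 0 < t ->
    ex_RInt_gen (fun w => J w / w * cos (w * t))
                (at_right 0) (Rbar_locally p_infty) /\
    K t = 2 / PI * RInt_gen (fun w => J w / w * cos (w * t))
                            (at_right 0) (Rbar_locally p_infty).

Definition scale_free (c beta : R) (J : R -> R) : Prop :=
  is_equiv (at_right 0) J (fun w => c * Rpower w beta).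

Definition C_beta (c beta : R) : R :=
  2 * c / PI * Gamma beta * cos (PI * beta / 2).

Definition is_power_law (beta : R) (k : R -> R) : Prop :=
  exists C, forall t, 0 < t -> k t = C * power_kernel beta t.

(* Main.v *)
(* For p(r) = r^(-beta) let P(x) = x^(1-beta)/(1-beta) be its primitive and Q
   the inverse of P.  The substitution y = P(t-s) turns the singular memory
   integral of u into the proper integral of u(t - Q(y)) over [0, P(t)].  By
   Leibniz' rule its derivative is the integral of u'(t - Q(y)) over [0, P(t)],
   i.e. the memory integral of u', plus the boundary term P'(t) u(0).  For the
   bath kernel, two equivalents of K that are multiples of t^(-beta) have the
   same constant, which is nonzero because Gamma(beta) > 0. *)
Require Import Defs.
From Stdlib Require Import Reals Lra Classical.
From Coquelicot Require Import Coquelicot.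
Open Scope R_scope.

(** * Real powers and positivity of the Gamma integral *)

Lemma is_derive_Rpower (x a : R) :
  0 < x -> is_derive (fun y => Rpower y a) x (a * Rpower x (a - 1)).
Proof.
  intros Hx. apply is_derive_Reals, derivable_pt_lim_power, Hx.
Qed.

Lemma continuous_Rpower (x a : R) : 0 < x -> continuous (fun y => Rpower y a) x.
Proof.
  intros Hx.
  apply (ex_derive_continuous (K := R_AbsRing) (V := R_NormedModule)).
  eexists. apply is_derive_Rpower, Hx.
Qed.

Lemma Rpower_pos (x a : R) : 0 < Rpower x a.
Proof. apply exp_pos. Qed.

(** [RInt_gen] is meaningful only once convergence is known, so convergence is proved along with the
    sign. The integrals of [f] over [a, b] grow with the interval and are bounded by 1/z + 1; their
    supremum [l] is the improper integral, and it is at least the positive integral over [1, 2]. *)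
Lemma Gamma_pos (z : R) : 0 < z <= 1 -> 0 < Gamma z.
Proof.
  intros Hz.
  set (f := fun x => Rpower x (z - 1) * exp (- x)).
  assert (f_pos : forall x, 0 < f x).
  { intros x. apply Rmult_lt_0_compat; apply exp_pos. }
  assert (cont_exp : forall x, continuous (fun x => exp (- x)) x).
  { intros x. apply (ex_derive_continuous (K := R_AbsRing) (V := R_NormedModule)).
    auto_derive. exact I. }
  assert (cont_f : forall x, 0 < x -> continuous f x).
  { intros x Hx.
    apply (continuous_mult (K := R_AbsRing)); [apply continuous_Rpower, Hx | apply cont_exp]. }
  assert (int_f : forall a b, 0 < a -> 0 < b -> ex_RInt f a b).
  { intros a b Ha Hb. apply (ex_RInt_continuous (V := R_CompleteNormedModule)).
    intros x [Hx _]. apply cont_f.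
    apply Rlt_le_trans with (2 := Hx), Rmin_glb_lt; assumption. }
  assert (mono : forall a' a b b', 0 < a' <= a -> a <= b <= b' -> RInt f a b <= RInt f a' b').
  { intros a' a b b' Ha Hb.
    rewrite <- (RInt_Chasles (V := R_CompleteNormedModule) f a' a b') by (apply int_f; lra).
    rewrite <- (RInt_Chasles (V := R_CompleteNormedModule) f a b b') by (apply int_f; lra).
    assert (0 <= RInt f a' a).
    { apply RInt_ge_0; [lra | apply int_f; lra | intros; apply Rlt_le, f_pos]. }
    assert (0 <= RInt f b b').
    { apply RInt_ge_0; [lra | apply int_f; lra | intros; apply Rlt_le, f_pos]. }
    unfold plus; simpl; lra. }
  (* On (0, 1] the exponential factor is at most 1, and x^(z-1) has the primitive x^z / z. *)
  assert (bound0 : forall a, 0 < a <= 1 -> RInt f a 1 <= / z).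
  { intros a Ha.
    assert (E : is_RInt (fun x => Rpower x (z - 1)) a 1
                  (minus (/ z * Rpower 1 z) (/ z * Rpower a z))).
    { apply (is_RInt_derive (V := R_CompleteNormedModule) (fun x => / z * Rpower x z)).
      - intros x Hx. rewrite Rmin_left in Hx by lra.
        replace (Rpower x (z - 1)) with (/ z * (z * Rpower x (z - 1))) by (field; lra).
        apply (is_derive_scal (fun y => Rpower y z)), is_derive_Rpower. lra.
      - intros x Hx. rewrite Rmin_left in Hx by lra. apply continuous_Rpower. lra. }
    apply Rle_trans with (RInt (fun x => Rpower x (z - 1)) a 1).
    - apply RInt_le; [lra | apply int_f; lra | eexists; exact E | ].
      intros x Hx. unfold f. rewrite <- (Rmult_1_r (Rpower x _)) at 2.
      apply Rmult_le_compat_l; [apply Rlt_le, Rpower_pos | ].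
      rewrite <- exp_0. apply Rlt_le, exp_increasing. lra.
    - rewrite (is_RInt_unique (V := R_CompleteNormedModule) _ _ _ _ E).
      assert (0 < / z * Rpower a z).
      { apply Rmult_lt_0_compat; [apply Rinv_0_lt_compat; lra | apply Rpower_pos]. }
      unfold Rpower at 1. rewrite ln_1, Rmult_0_r, exp_0.
      unfold minus, plus, opp; simpl. lra. }
  (* For x >= 1 the power is at most 1 because z <= 1, which leaves exp(-x). *)
  assert (bound1 : forall b, 1 <= b -> RInt f 1 b <= 1).
  { intros b Hb.
    assert (E : is_RInt (fun x => exp (- x)) 1 b (minus (- exp (- b)) (- exp (- 1)))).
    { apply (is_RInt_derive (V := R_CompleteNormedModule) (fun x => - exp (- x))).
      - intros x _. auto_derive; [exact I | ring].
      - intros x _. apply cont_exp. }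
    apply Rle_trans with (RInt (fun x => exp (- x)) 1 b).
    - apply RInt_le; [lra | apply int_f; lra | eexists; exact E | ].
      intros x Hx. unfold f. rewrite <- (Rmult_1_l (exp (- x))) at 2.
      apply Rmult_le_compat_r; [apply Rlt_le, exp_pos | ].
      apply Rle_trans with (exp 0); [unfold Rpower | apply Req_le, exp_0].
      assert (0 <= (1 - z) * ln x).
      { apply Rmult_le_pos; [lra | rewrite <- ln_1; apply ln_le; lra]. }
      destruct (Rle_lt_or_eq_dec _ _ H) as [H' | H'].
      + apply Rlt_le, exp_increasing. lra.
      + apply Req_le. f_equal. lra.
    - rewrite (is_RInt_unique (V := R_CompleteNormedModule) _ _ _ _ E).
      assert (0 < exp (- b)) by apply exp_pos.
      assert (exp (- 1) < 1) by (rewrite <- exp_0; apply exp_increasing; lra).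
      unfold minus, plus, opp; simpl. lra. }
  set (E := fun v => exists a b, 0 < a <= 1 /\ 1 <= b /\ v = RInt f a b).
  destruct (completeness E) as [l [l_ub l_least]].
  { exists (/ z + 1). intros v (a & b & Ha & Hb & ->).
    rewrite <- (RInt_Chasles (V := R_CompleteNormedModule) f a 1 b) by (apply int_f; lra).
    apply Rplus_le_compat; [apply bound0 | apply bound1]; lra. }
  { exists (RInt f 1 1), 1, 1. repeat split; lra. }
  assert (l_pos : 0 < l).
  { apply Rlt_le_trans with (RInt f 1 2).
    - apply RInt_gt_0; [lra | intros; apply f_pos | intros; apply cont_f; lra].
    - apply l_ub. exists 1, 2. repeat split; lra. }
  unfold Gamma. fold f.
  rewrite (is_RInt_gen_unique (V := R_CompleteNormedModule) f l); [exact l_pos | ].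
  intros P [eps HP].
  (* One integral within [eps] of the supremum suffices: by [mono], every larger interval does at
     least as well. *)
  assert (near_l : exists v, E v /\ l - eps < v).
  { apply NNPP. intros no_v. assert (l <= l - eps); [ | destruct eps; simpl in *; lra].
    apply l_least. intros v Ev. apply Rnot_lt_le. intros Hv. apply no_v. now exists v. }
  destruct near_l as (v & (a0 & b0 & Ha0 & Hb0 & ->) & Hv).
  apply (Filter_prod _ _ _ (fun a => 0 < a <= a0) (fun b => b0 <= b)).
  - exists (mkposreal a0 (proj1 Ha0)). intros a Ba Ha.
    change (Rabs (a - 0) < a0) in Ba. apply Rabs_lt_between in Ba. lra.
  - exists b0. intros b Hb. lra.
  - intros a b Ha Hb. exists (RInt f a b). split.
    + apply (RInt_correct (V := R_CompleteNormedModule)), int_f; lra.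
    + apply HP. change (Rabs (RInt f a b - l) < eps).
      assert (RInt f a0 b0 <= RInt f a b) by (apply mono; lra).
      assert (RInt f a b <= l) by (apply l_ub; exists a, b; repeat split; lra).
      apply Rabs_lt_between. destruct eps; simpl in *; lra.
Qed.

(** * First-order errors and derivatives relative to a set *)

Lemma scal_Rplus {X : ModuleSpace R_AbsRing} (a b : R) (x : X) :
  scal (a + b) x = plus (scal a x) (scal b x).
Proof. exact (scal_distr_r a b x). Qed.

(** Splits the first-order error of the affine extension in [C1_RInt] into two terms that are
    estimated separately. *)
Lemma minus_plus_plus {G : AbelianGroup} (a b p q r : G) :
  minus (minus (plus a p) b) (plus q r) = plus (minus (minus a b) q) (minus p r).
Proof.
  unfold minus. rewrite opp_plus, <- !plus_assoc. f_equal.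
  rewrite plus_comm, <- !plus_assoc. do 2 f_equal.
  apply plus_comm.
Qed.

Lemma plus_minus_r {G : AbelianGroup} (a b : G) : plus a (minus b a) = b.
Proof.
  change (plus a (plus b (opp a)) = b).
  now rewrite plus_assoc, (plus_comm a b), <- plus_assoc, plus_opp_r, plus_zero_r.
Qed.

Lemma norm_le_plus {X : NormedModule R_AbsRing} (x y z : X) (a b c : R) :
  x = plus y z -> norm y <= a -> norm z <= b -> a + b <= c -> norm x <= c.
Proof.
  intros -> Hy Hz Hc. apply Rle_trans with (1 := norm_triangle y z). lra.
Qed.

(** [filterdiff] asks for the estimate at every limit of the filter; the limit is unique, so the
    estimate at [t] suffices. *)
Lemma is_derive_of_bound {X : NormedModule R_AbsRing} (f : R -> X) (t : R) (l : X) :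
  (forall eps : posreal, locally t (fun s =>
     norm (minus (minus (f s) (f t)) (scal (s - t) l)) <= eps * Rabs (s - t))) ->
  is_derive f t l.
Proof.
  intros H. split; [apply is_linear_scal_l | ].
  intros x Hx eps.
  rewrite <- (is_filter_lim_locally_unique (V := R_NormedModule) _ _ Hx).
  apply H.
Qed.

Lemma is_derive_within_bound {X : NormedModule R_AbsRing} (D : R -> Prop) (f : R -> X)
    (t : R) (l : X) (eps : posreal) :
  is_derive_within D f t l ->
  locally t (fun s => D s ->
    norm (minus (minus (f s) (f t)) (scal (s - t) l)) <= eps * Rabs (s - t)).
Proof.
  intros [_ H]. apply (H t); intros P HP. now apply filter_le_within.
Qed.

(** Only values on [D] near [t] enter a relative derivative, so [g] may be traded for a function
    with a two-sided derivative. Since [t] lies in [D], the relative filter is proper and its limit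
    is unique. *)
Lemma is_derive_within_of_is_derive {X : NormedModule R_AbsRing} (D : R -> Prop)
    (f g : R -> X) (t : R) (l : X) :
  D t -> locally t (fun s => D s -> g s = f s) -> is_derive f t l ->
  is_derive_within D g t l.
Proof.
  intros Dt Hfg Hf.
  assert (proper : ProperFilter (within D (locally t))).
  { constructor; [ | apply within_filter, locally_filter].
    intros P HP. exists t. exact (locally_singleton _ _ HP Dt). }
  assert (lim : is_filter_lim (within D (locally t)) t).
  { intros P HP. now apply filter_le_within. }
  apply (filterdiff_ext_loc f).
  - unfold within. revert Hfg. apply filter_imp. intros s Hs Ds. symmetry. auto.
  - intros x Hx. rewrite <- (is_filter_lim_unique (V := R_NormedModule) _ _ lim Hx).
    symmetry. now apply (locally_singleton _ _ Hfg).
  - now apply (filterdiff_locally _ t).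
Qed.

Lemma locally_norm_le {X : NormedModule R_AbsRing} {T : UniformSpace} (f : T -> X)
    (x : T) (eps : posreal) :
  continuous f x -> locally x (fun y => norm (minus (f y) (f x)) <= eps).
Proof.
  intros Hf. apply (Hf (fun z => norm (minus z (f x)) <= eps)).
  apply locally_le_locally_norm. exists eps.
  intros y Hy. now apply Rlt_le.
Qed.

(** * Extension beyond the segment and the fundamental theorem of calculus *)

Definition clamp (T t : R) : R := Rmax 0 (Rmin T t).

Lemma clamp_in (T t : R) : 0 <= T -> segment T (clamp T t).
Proof.
  intros HT. unfold clamp, segment, Rmax, Rmin. repeat destruct Rle_dec; lra.
Qed.

Lemma clamp_id (T t : R) : segment T t -> clamp T t = t.
Proof.
  unfold clamp, segment, Rmax, Rmin. repeat destruct Rle_dec; lra.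
Qed.

Lemma clamp_dist (T s t : R) : Rabs (clamp T s - clamp T t) <= Rabs (s - t).
Proof.
  unfold clamp, Rmax, Rmin, Rabs. repeat destruct Rle_dec; repeat destruct Rcase_abs; lra.
Qed.

(* clamp T s is the point of the segment nearest to s. *)
Lemma clamp_excess (T s t : R) : segment T t -> Rabs (s - clamp T s) <= Rabs (s - t).
Proof.
  unfold clamp, segment, Rmax, Rmin, Rabs.
  repeat destruct Rle_dec; repeat destruct Rcase_abs; lra.
Qed.

(** The clamp is 1-Lipschitz with values in the segment, so relative continuity of [f] becomes
    continuity on the whole line. *)
Lemma continuous_clamp {X : UniformSpace} (T : R) (f : R -> X) :
  0 <= T -> continuous_on (segment T) f -> forall t, continuous (fun s => f (clamp T s)) t.
Proof.
  intros HT Hf t P HP.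
  destruct (Hf _ (clamp_in T t HT) P HP) as [d Hd].
  exists d. intros s Hs. apply Hd; [ | now apply clamp_in].
  apply Rle_lt_trans with (2 := Hs). apply clamp_dist.
Qed.

(* The affine extension of u beyond the segment is two-sided differentiable on
   it, so that the two-sided fundamental theorem of calculus applies. *)
Lemma C1_RInt {X : CompleteNormedModule R_AbsRing} (T : R) (u du : R -> X) (t : R) :
  0 <= T -> is_C1 T u du -> segment T t ->
  u t = plus (u 0) (RInt (fun s => du (clamp T s)) 0 t).
Proof.
  intros HT [Du Cdu] Ht.
  set (w := fun s => du (clamp T s)).
  set (v := fun s => plus (u (clamp T s)) (scal (s - clamp T s) (w s))).
  assert (Cw : forall s, continuous w s) by now apply continuous_clamp.
  assert (Ev : forall s, segment T s -> v s = u s).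
  { intros s Hs. unfold v. rewrite clamp_id, Rminus_diag by assumption.
    rewrite <- (plus_zero_r (u s)) at 2. f_equal. exact (scal_zero_l (w s)). }
  assert (H0 : segment T 0) by (unfold segment; lra).
  assert (E : is_RInt w 0 t (minus (v t) (v 0))).
  { apply (is_RInt_derive v w); [ | intros; apply Cw].
    intros x Hx.
    assert (Sx : segment T x).
    { unfold segment in *. rewrite Rmin_left, Rmax_right in Hx by lra. lra. }
    apply is_derive_of_bound. intros eps.
    assert (pos : 0 < eps / 2) by (destruct eps; simpl; lra).
    destruct (is_derive_within_bound _ _ _ _ (mkposreal _ pos) (Du x Sx)) as [d Hd].
    destruct (locally_norm_le w x (mkposreal _ pos) (Cw x)) as [d' Hd'].
    exists (mkposreal _ (Rmin_pos _ _ (cond_pos d) (cond_pos d'))).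
    intros s Hs. change (Rabs (s - x) < Rmin d d') in Hs.
    assert (Hcs : Rabs (clamp T s - x) <= Rabs (s - x)).
    { rewrite <- (clamp_id T x Sx) at 1. apply clamp_dist. }
    rewrite (Ev x Sx).
    (* The first term is the error of [u] at the nearest point of the segment, governed by the
       one-sided derivative; the second is the overshoot times the variation of [w]. Each is at most
       eps/2 times |s - x|. *)
    assert (split : minus (minus (v s) (u x)) (scal (s - x) (w x)) =
      plus (minus (minus (u (clamp T s)) (u x)) (scal (clamp T s - x) (du x)))
           (scal (s - clamp T s) (minus (w s) (w x)))).
    { unfold v. replace (du x) with (w x) by (unfold w; now rewrite clamp_id).
      replace (s - x) with ((clamp T s - x) + (s - clamp T s)) by ring.
      rewrite scal_Rplus.
      etransitivity; [apply (minus_plus_plus (G := X)) | ].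
      apply (f_equal2 plus); [reflexivity | ].
      symmetry. exact (scal_minus_distr_l (V := X) (s - clamp T s) (w s) (w x)). }
    apply (norm_le_plus (X := X) _ _ _ (eps / 2 * Rabs (s - x)) (Rabs (s - x) * (eps / 2)) _ split);
      [ | | apply Req_le; field].
    - apply Rle_trans with (eps / 2 * Rabs (clamp T s - x)).
      + apply Hd; [ | now apply clamp_in].
        apply Rle_lt_trans with (1 := Hcs), Rlt_le_trans with (1 := Hs), Rmin_l.
      + apply Rmult_le_compat_l; [lra | exact Hcs].
    - apply Rle_trans with (1 := norm_scal (V := X) _ _).
      apply Rmult_le_compat; [apply Rabs_pos | apply norm_ge_0 | now apply clamp_excess | ].
      apply Hd', Rlt_le_trans with (1 := Hs), Rmin_r. }
  rewrite (is_RInt_unique _ _ _ _ E), !Ev by assumption.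
  symmetry. apply (plus_minus_r (G := X)).
Qed.

(** * Leibniz' rule for a delayed integrand and a moving end point *)

Lemma is_derive_increment_bound {X : CompleteNormedModule R_AbsRing} (U w : R -> X) (s t e : R) :
  (forall x, is_derive U x (w x)) -> (forall x, continuous w x) ->
  (forall x, Rmin t s <= x <= Rmax t s -> norm (minus (w x) (w t)) <= e) ->
  norm (minus (minus (U s) (U t)) (scal (s - t) (w t))) <= Rabs (s - t) * e.
Proof.
  intros DU Cw He.
  (* The error is the integral of [w x - w t] from [t] to [s]. *)
  apply (norm_RInt_le_const_abs (V := X) _ _ _ _ _ He).
  apply (is_RInt_minus (V := X)); [ | exact (is_RInt_const (V := X) t s (w t))].
  apply (is_RInt_derive U w); intros; [apply DU | apply Cw].
Qed.

Lemma Rabs_between (a b x : R) : Rmin a b <= x <= Rmax a b -> Rabs (x - a) <= Rabs (b - a).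
Proof.
  unfold Rmin, Rmax, Rabs. destruct Rle_dec; repeat destruct Rcase_abs; lra.
Qed.

Section MovingRInt.

Context {X : CompleteNormedModule R_AbsRing}.
Variables (U w : R -> X) (P Q : R -> R) (t p : R).
Hypothesis DU : forall x, is_derive U x (w x).
Hypothesis Cw : forall x, continuous w x.
Hypothesis CQ : forall y, continuous Q y.
Hypothesis DP : is_derive P t p.
Hypothesis P_pos : 0 <= P t.
Hypothesis Q_range : forall y, 0 <= y <= P t -> 0 <= Q y <= t.
Hypothesis QP : Q (P t) = t.

Let continuous_delay (V : R -> X) (s : R) (CV : forall x, continuous V x) :
  forall y, continuous (fun y => V (s - Q y)) y.
Proof.
  intros y. apply (continuous_comp (fun y => s - Q y) V); [ | apply CV].
  apply (continuous_minus (K := R_AbsRing) (V := R_NormedModule));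
    [apply continuous_const | apply CQ].
Qed.

Let CU (x : R) : continuous U x.
Proof.
  apply (ex_derive_continuous (K := R_AbsRing) (V := X)). eexists. apply DU.
Qed.

(** With the interval frozen, only the integrand varies. Uniform continuity of [w] on a compact
    interval makes the first-order error of [U] small uniformly in y, and this error is then
    integrated. *)
Lemma is_derive_RInt_delay_fixed :
  is_derive (fun s => RInt (fun y => U (s - Q y)) 0 (P t)) t
    (RInt (fun y => w (t - Q y)) 0 (P t)).
Proof.
  apply is_derive_of_bound. intros eps.
  (* Integration over [0, P t] costs a factor [P t]; the added 1 keeps the denominator positive when
     [P t] is 0. *)
  assert (e_pos : 0 < eps / (P t + 1)).
  { apply Rdiv_lt_0_compat; [apply cond_pos | lra]. }
  (* As 0 <= Q y <= t and |s - t| < 1, all points between t - Q y and s - Q y lie in [-1, t + 1]. *)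
  destruct (unifcont_normed_1d w (- 1) (t + 1) (fun x _ => Cw x) (mkposreal _ e_pos))
    as [d Hd].
  exists (mkposreal _ (Rmin_pos _ _ Rlt_0_1 (cond_pos d))).
  intros s Hs. change (Rabs (s - t) < Rmin 1 d) in Hs.
  assert (Hs1 := Rlt_le_trans _ _ _ Hs (Rmin_l _ _)).
  assert (Hs2 := Rlt_le_trans _ _ _ Hs (Rmin_r _ _)).
  apply Rle_trans with (Rabs (P t - 0) * (Rabs (s - t) * (eps / (P t + 1)))).
  - apply (norm_RInt_le_const_abs (V := X) (fun y =>
      minus (minus (U (s - Q y)) (U (t - Q y))) (scal (s - t) (w (t - Q y))))).
    + intros y Hy. rewrite Rmin_left, Rmax_right in Hy by lra.
      specialize (Q_range y Hy).
      replace (s - t) with ((s - Q y) - (t - Q y)) by ring.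
      apply is_derive_increment_bound; [exact DU | exact Cw | ].
      intros x Hx. apply Rabs_between in Hx.
      replace (s - Q y - (t - Q y)) with (s - t) in Hx by ring.
      assert (Hx1 := proj1 (Rabs_lt_between _ _) (Rle_lt_trans _ _ _ Hx Hs1)).
      apply Rlt_le, Hd; [lra | lra | ].
      exact (Rle_lt_trans _ _ _ Hx Hs2).
    + apply (is_RInt_minus (V := X)); [apply (is_RInt_minus (V := X)) | apply (is_RInt_scal (V := X))];
        apply (RInt_correct (V := X)), ex_RInt_continuous; intros;
        apply continuous_delay; assumption.
  - rewrite Rminus_0_r, Rabs_pos_eq by assumption.
    replace (P t * (Rabs (s - t) * (eps / (P t + 1))))
      with (P t / (P t + 1) * (eps * Rabs (s - t))) by (field; lra).
    rewrite <- (Rmult_1_l (eps * Rabs (s - t))) at 2.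
    apply Rmult_le_compat_r.
    + apply Rmult_le_pos; [apply Rlt_le, cond_pos | apply Rabs_pos].
    + apply Rmult_le_reg_r with (P t + 1); [lra | ]. field_simplify; lra.
Qed.

(** The interval from P t to P s has length O(|s - t|), and on it s - Q y is close to t - Q (P t) =
    0, so the integrand is small and the integral is o(|s - t|). *)
Lemma is_derive_RInt_delay_corner :
  is_derive (fun s => RInt (fun y => minus (U (s - Q y)) (U 0)) (P t) (P s)) t zero.
Proof.
  apply is_derive_of_bound. intros eps.
  rewrite RInt_point.
  (* Near [t], differentiability with tolerance 1 gives |P s - P t| <= m |s - t|. *)
  set (m := Rabs p + 1).
  assert (m_pos : 0 < m) by (assert (H := Rabs_pos p); unfold m; lra).
  assert (e_pos : 0 < eps / m) by (apply Rdiv_lt_0_compat; [apply cond_pos | lra]).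
  destruct (locally_norm_le U 0 (mkposreal _ e_pos) (CU 0)) as [d0 Hd0].
  (* Half of [d0] is for s - t and half for Q y - t, whose difference is s - Q y. *)
  assert (d0_pos : 0 < d0 / 2) by (destruct d0; simpl; lra).
  destruct (locally_norm_le (X := R_NormedModule) Q (P t) (mkposreal _ d0_pos) (CQ _)) as [d1 Hd1].
  rewrite QP in Hd1.
  assert (d2_pos : 0 < d1 / m) by (apply Rdiv_lt_0_compat; [apply cond_pos | lra]).
  destruct DP as [_ DP']. destruct (DP' t (fun _ H => H) (mkposreal _ Rlt_0_1)) as [d3 Hd3].
  exists (mkposreal _ (Rmin_pos _ _ (cond_pos d3) (Rmin_pos _ _ d0_pos d2_pos))).
  intros s Hs. change (Rabs (s - t) < Rmin d3 (Rmin (d0 / 2) (d1 / m))) in Hs.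
  assert (Hs3 := Rlt_le_trans _ _ _ Hs (Rmin_l _ _)).
  assert (Hs' := Rlt_le_trans _ _ _ Hs (Rmin_r _ _)).
  assert (Hs0 := Rlt_le_trans _ _ _ Hs' (Rmin_l _ _)).
  assert (Hs2 := Rlt_le_trans _ _ _ Hs' (Rmin_r _ _)).
  assert (Pinc : Rabs (P s - P t) <= m * Rabs (s - t)).
  { specialize (Hd3 s Hs3).
    change (Rabs (P s - P t - (s - t) * p) <= 1 * Rabs (s - t)) in Hd3.
    replace (P s - P t) with ((P s - P t - (s - t) * p) + (s - t) * p) by ring.
    apply Rle_trans with (1 := Rabs_triang _ _). rewrite Rabs_mult. unfold m. lra. }
  assert (small : m * Rabs (s - t) < d1).
  { apply Rmult_lt_reg_l with (/ m); [now apply Rinv_0_lt_compat | ].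
    rewrite <- Rmult_assoc, Rinv_l, Rmult_1_l by lra. now rewrite Rmult_comm. }
  apply Rle_trans with (Rabs (P s - P t) * (eps / m)).
  (* The function vanishes at [t] and so does the candidate derivative, so the error is the integral
     itself. *)
  - replace (minus _ _) with (RInt (fun y => minus (U (s - Q y)) (U 0)) (P t) (P s)).
    + apply (norm_RInt_le_const_abs (V := X) (fun y => minus (U (s - Q y)) (U 0)) (P t) (P s)).
      * intros y Hy. apply Rabs_between in Hy. apply Hd0.
        assert (HQ : Rabs (Q y - t) <= d0 / 2).
        { apply Hd1. exact (Rle_lt_trans _ _ _ Hy (Rle_lt_trans _ _ _ Pinc small)). }
        change (Rabs (s - Q y - 0) < d0).
        apply Rabs_le_between in HQ. apply Rabs_lt_between in Hs0. apply Rabs_lt_between. lra.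
      * apply (RInt_correct (V := X)), (ex_RInt_continuous (V := X)). intros y _.
        apply (continuous_minus (V := X)); [now apply continuous_delay | apply continuous_const].
    + symmetry. etransitivity; [ | etransitivity; apply (minus_zero_r (G := X))].
      exact (f_equal (minus _) (scal_zero_r (V := X) (s - t))).
  - replace (eps * Rabs (s - t)) with (m * Rabs (s - t) * (eps / m)) by (field; lra).
    apply Rmult_le_compat_r; [lra | exact Pinc].
Qed.

(** The integral is split at P t, and U 0 is subtracted on the moving piece. The subtracted part is
    (P s - P t) U 0, the source of the boundary term. *)
Lemma is_derive_RInt_delay :
  is_derive (fun s => RInt (fun y => U (s - Q y)) 0 (P s)) t
    (plus (RInt (fun y => w (t - Q y)) 0 (P t)) (scal p (U 0))).
Proof.
  apply (is_derive_ext (fun s => plus (RInt (fun y => U (s - Q y)) 0 (P t))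
    (plus (RInt (fun y => minus (U (s - Q y)) (U 0)) (P t) (P s)) (scal (P s - P t) (U 0))))).
  - intros s.
    assert (ex : forall a b, ex_RInt (fun y => U (s - Q y)) a b).
    { intros a b. apply (ex_RInt_continuous (V := X)). intros. now apply continuous_delay. }
    rewrite <- (RInt_Chasles (fun y => U (s - Q y)) 0 (P t) (P s)) by apply ex.
    rewrite (RInt_minus (fun y => U (s - Q y)) (fun _ => U 0)) by (apply ex || apply ex_RInt_const).
    rewrite RInt_const. apply (f_equal2 plus); [reflexivity | ].
    etransitivity; [apply (plus_comm (G := X)) | apply (plus_minus_r (G := X))].
  - apply (is_derive_plus (V := X)); [exact is_derive_RInt_delay_fixed | ].
    rewrite <- (plus_zero_l (G := X) (scal p (U 0))).
    apply (is_derive_plus (V := X)); [exact is_derive_RInt_delay_corner | ].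
    apply (is_derive_scal_l (V := X) (fun s => P s - P t)).
    rewrite <- (Rminus_0_r p).
    apply (is_derive_minus (V := R_NormedModule) P (fun _ => P t));
      [exact DP | exact (is_derive_const (V := R_NormedModule) (P t) t)].
Qed.

End MovingRInt.

(** * Powers extended by zero to the whole line *)

Definition pos_power (a x : R) : R := if Rle_dec x 0 then 0 else Rpower x a.

Lemma pos_power_pos (a x : R) : 0 < x -> pos_power a x = Rpower x a.
Proof. intros Hx. unfold pos_power. destruct Rle_dec; lra. Qed.

Lemma pos_power_ge_0 (a x : R) : 0 <= pos_power a x.
Proof.
  unfold pos_power. destruct Rle_dec; [lra | apply Rlt_le, Rpower_pos].
Qed.

Lemma pos_power_0 (a : R) : pos_power a 0 = 0.
Proof. unfold pos_power. destruct Rle_dec; lra. Qed.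

Lemma pos_power_incr (a x y : R) : 0 < a -> x <= y -> pos_power a x <= pos_power a y.
Proof.
  intros Ha Hxy. destruct (Rle_dec x 0) as [Hx | Hx].
  - unfold pos_power at 1. destruct Rle_dec; [apply pos_power_ge_0 | lra].
  - rewrite !pos_power_pos by lra. apply Rle_Rpower_l; lra.
Qed.

Lemma pos_power_inv (a x : R) : 0 < a -> 0 <= x -> pos_power (/ a) (pos_power a x) = x.
Proof.
  intros Ha [Hx | <-]; [ | now rewrite !pos_power_0].
  rewrite (pos_power_pos a), pos_power_pos by (assumption || apply Rpower_pos).
  rewrite Rpower_mult, Rinv_r, Rpower_1; lra.
Qed.

(** [Rpower] takes the value 1 at nonpositive arguments; the value 0 of [pos_power] there removes
    the jump, since y^a < e for 0 < y < e^(1/a). *)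
Lemma continuous_pos_power (a x : R) : 0 < a -> continuous (pos_power a) x.
Proof.
  intros Ha. destruct (Rtotal_order x 0) as [Hx | [-> | Hx]].
  - apply (continuous_ext_loc _ (fun _ => 0)); [ | apply continuous_const].
    exists (mkposreal (- x) ltac:(lra)). intros y Hy.
    change (Rabs (y - x) < - x) in Hy. apply Rabs_lt_between in Hy.
    unfold pos_power. destruct Rle_dec; lra.
  - intros P [e He]. rewrite pos_power_0 in He.
    exists (mkposreal _ (Rpower_pos e (/ a))). intros y Hy.
    change (Rabs (y - 0) < Rpower e (/ a)) in Hy. apply Rabs_lt_between in Hy.
    apply He. change (Rabs (pos_power a y - 0) < e).
    rewrite Rminus_0_r, Rabs_pos_eq by apply pos_power_ge_0.
    assert (He' := cond_pos e).
    destruct (Rle_dec y 0) as [Hy' | Hy'].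
    + unfold pos_power. destruct Rle_dec; lra.
    + rewrite pos_power_pos by lra.
      rewrite <- (Rpower_1 e), <- (Rinv_l a), <- Rpower_mult by lra.
      apply Rlt_Rpower_l; lra.
  - apply (continuous_ext_loc _ (fun y => Rpower y a)); [ | now apply continuous_Rpower].
    exists (mkposreal x Hx). intros y Hy.
    change (Rabs (y - x) < x) in Hy. apply Rabs_lt_between in Hy.
    symmetry. apply pos_power_pos. lra.
Qed.

(** * The primitive of the power kernel and its inverse *)

Definition kernel_primitive (beta x : R) : R := pos_power (1 - beta) x / (1 - beta).

Definition kernel_primitive_inv (beta y : R) : R := pos_power (/ (1 - beta)) ((1 - beta) * y).

Section Kernel.

Variable beta : R.
Hypothesis Hbeta : 0 < beta < 1.

Local Notation P := (kernel_primitive beta).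
Local Notation Q := (kernel_primitive_inv beta).

Lemma kernel_primitive_inv_l (x : R) : 0 <= x -> Q (P x) = x.
Proof.
  intros Hx. unfold kernel_primitive_inv, kernel_primitive.
  replace ((1 - beta) * (pos_power (1 - beta) x / (1 - beta)))
    with (pos_power (1 - beta) x) by (field; lra).
  apply pos_power_inv; lra.
Qed.

Lemma kernel_primitive_ge_0 (x : R) : 0 <= P x.
Proof.
  apply Rmult_le_pos; [apply pos_power_ge_0 | apply Rlt_le, Rinv_0_lt_compat; lra].
Qed.

Lemma kernel_primitive_0 : P 0 = 0.
Proof. unfold kernel_primitive. rewrite pos_power_0. lra. Qed.

Lemma kernel_primitive_inv_range (t y : R) : 0 <= t -> 0 <= y <= P t -> 0 <= Q y <= t.
Proof.
  intros Ht Hy. split; [apply pos_power_ge_0 | ].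
  rewrite <- (kernel_primitive_inv_l t Ht).
  apply pos_power_incr; [apply Rinv_0_lt_compat; lra | ].
  apply Rmult_le_compat_l; lra.
Qed.

(** Includes the singular point 0 of the kernel, because 1 - beta > 0; convergence of the memory
    integral rests on this. *)
Lemma continuous_kernel_primitive (x : R) : continuous P x.
Proof.
  apply (continuous_mult (K := R_AbsRing) (pos_power (1 - beta)) (fun _ => / (1 - beta)));
    [apply continuous_pos_power; lra | apply continuous_const].
Qed.

Lemma continuous_kernel_primitive_inv (y : R) : continuous Q y.
Proof.
  apply (continuous_comp (fun y => (1 - beta) * y) (pos_power (/ (1 - beta)))).
  - apply (continuous_mult (K := R_AbsRing) (fun _ => 1 - beta) (fun y => y));
      [apply continuous_const | apply continuous_id].
  - apply continuous_pos_power, Rinv_0_lt_compat. lra.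
Qed.

Lemma is_derive_kernel_primitive (x : R) : 0 < x -> is_derive P x (power_kernel beta x).
Proof.
  intros Hx.
  apply (is_derive_ext_loc (fun y => / (1 - beta) * Rpower y (1 - beta))).
  - exists (mkposreal x Hx). intros y Hy.
    change (Rabs (y - x) < x) in Hy. apply Rabs_lt_between in Hy.
    unfold kernel_primitive. rewrite pos_power_pos by lra. apply Rmult_comm.
  - replace (power_kernel beta x)
      with (/ (1 - beta) * ((1 - beta) * Rpower x (1 - beta - 1))).
    + apply is_derive_scal, is_derive_Rpower, Hx.
    + unfold power_kernel. replace (1 - beta - 1) with (- beta) by ring. field. lra.
Qed.

(** * Memory integrals as proper integrals, and their derivative *)

Context {X : CompleteNormedModule R_AbsRing}.

(** For b < t the substitution y = P (t - s) absorbs the kernel and turns the integral over [0, b]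
    into that of a continuous function over [P (t - b), P t]. The lower end tends to 0 as b tends to
    t. *)
Lemma is_RInt_gen_memory (u U : R -> X) (t : R) :
  0 < t -> (forall s, continuous U s) -> (forall s, 0 < s < t -> U s = u s) ->
  is_RInt_gen (fun s => scal (power_kernel beta (t - s)) (u s)) (at_point 0) (at_left t)
    (RInt (fun y => U (t - Q y)) 0 (P t)).
Proof.
  intros Ht CU HU.
  set (f := fun y => U (t - Q y)).
  assert (Cf : forall y, continuous f y).
  { intros y. apply (continuous_comp (fun y => t - Q y) U); [ | apply CU].
    apply (continuous_minus (K := R_AbsRing) (V := R_NormedModule));
      [apply continuous_const | apply continuous_kernel_primitive_inv]. }
  assert (ex : forall a b, ex_RInt f a b).
  { intros a b. apply (ex_RInt_continuous (V := X)). intros. apply Cf. }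
  (* Here x stands for t - b, the distance to the singular end. *)
  assert (Clim : continuous (fun x => RInt f (P x) (P t)) 0).
  { apply (continuous_comp P (fun y => RInt f y (P t))).
    - apply continuous_kernel_primitive.
    - apply (ex_derive_continuous (K := R_AbsRing) (V := X)). eexists.
      apply (is_derive_RInt' (V := X) f _ (P 0) (P t)); [ | apply Cf].
      exists (mkposreal _ Rlt_0_1). intros y _. apply (RInt_correct (V := X)), ex. }
  intros A HA. rewrite <- kernel_primitive_0 in HA.
  destruct (Clim A HA) as [d Hd].
  apply (Filter_prod _ _ _ (fun a => a = 0) (fun b => 0 < b < t /\ t - b < d)).
  - reflexivity.
  - exists (mkposreal _ (Rmin_pos _ _ (cond_pos d) Ht)). intros b Hb Hbt.
    change (Rabs (b - t) < Rmin d t) in Hb. apply Rabs_lt_between in Hb.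
    assert (H1 := Rmin_l d t). assert (H2 := Rmin_r d t). lra.
  - intros a b -> [Hb Hbd]. exists (RInt f (P (t - b)) (P t)). split.
    (* P (t - s) decreases in s, so the integral runs from P t down to P (t - b); this sign cancels
       that of the derivative. *)
    + rewrite <- (opp_RInt_swap f (P t) (P (t - b))) by apply ex. simpl.
      apply (is_RInt_ext (V := X) (fun s => opp (scal (- power_kernel beta (t - s)) (f (P (t - s)))))).
      { intros s Hs. rewrite Rmin_left, Rmax_right in Hs by lra.
        unfold f. rewrite kernel_primitive_inv_l by lra.
        replace (t - (t - s)) with s by ring. rewrite HU by lra.
        etransitivity; [symmetry; apply (scal_opp_l (V := X)) | ].
        apply (f_equal2 scal); [apply Ropp_involutive | reflexivity]. }
      apply (is_RInt_opp (V := X)).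
      assert (comp := is_RInt_comp f (fun s => P (t - s)) (fun s => - power_kernel beta (t - s)) 0 b).
      simpl in comp. rewrite Rminus_0_r in comp. apply comp.
      { intros. apply Cf. }
      intros s Hs. rewrite Rmin_left, Rmax_right in Hs by lra. split.
      * replace (- power_kernel beta (t - s)) with (- 1 * power_kernel beta (t - s)) by ring.
        apply (is_derive_comp P (fun s => t - s)).
        -- apply is_derive_kernel_primitive. lra.
        -- auto_derive; [exact I | ring].
      * apply (continuous_opp (V := R_NormedModule)).
        apply (continuous_comp (fun s => t - s) (power_kernel beta)).
        -- apply (continuous_minus (K := R_AbsRing) (V := R_NormedModule));
             [apply continuous_const | apply continuous_id].
        -- apply continuous_Rpower. lra.
    + apply Hd. change (Rabs (t - b - 0) < d). rewrite Rminus_0_r, Rabs_pos_eq; lra.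
Qed.

Lemma is_RInt_gen_memory_scal (C : R) (k : R -> R) (u : R -> X) (t : R) (l : X) :
  0 < t -> (forall x, 0 < x -> k x = C * power_kernel beta x) ->
  is_RInt_gen (fun s => scal (power_kernel beta (t - s)) (u s)) (at_point 0) (at_left t) l ->
  is_RInt_gen (fun s => scal (k (t - s)) (u s)) (at_point 0) (at_left t) (scal C l).
Proof.
  intros Ht Hk Hl. apply (is_RInt_gen_scal (V := X) _ C) in Hl.
  revert Hl. apply (is_RInt_gen_ext (V := X)).
  apply (Filter_prod _ _ _ (fun a => a = 0) (fun b => b < t)); [reflexivity | | ].
  - exists (mkposreal _ Rlt_0_1). auto.
  - intros a b -> Hb s Hs. simpl in Hs.
    (* Only b < t is known and b may be negative; in either case s < max(0, b) < t. *)
    assert (Hst : s < t) by (unfold Rmax in Hs; destruct Rle_dec; lra).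
    rewrite Hk by lra. apply (scal_assoc (V := X)).
Qed.

(** Serves both claims of the theorem: C = 1 for the power kernel itself, general C for a power law.
    A C^1 extension [U] of [u] to the whole line makes the two-sided Leibniz rule applicable, also
    at t = T. *)
Lemma memory_derivative (T C : R) (k : R -> R) (u du : R -> X) (t : R) :
  is_C1 T u du -> 0 < t <= T -> (forall x, 0 < x -> k x = C * power_kernel beta x) ->
  ex_memory k u t /\ ex_memory (power_kernel beta) du t /\
  is_derive_within (segment T) (memory k u) t
    (scal C (plus (memory (power_kernel beta) du t) (scal (Rpower t (- beta)) (u 0)))).
Proof.
  intros Hu Ht Hk.
  assert (HT : 0 <= T) by lra.
  set (w := fun s => du (clamp T s)).
  set (U := fun s => plus (u 0) (RInt w 0 s)).
  assert (Cw : forall s, continuous w s) by now apply continuous_clamp, Hu.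
  assert (DU : forall s, is_derive U s (w s)).
  { intros s. rewrite <- (plus_zero_l (G := X) (w s)).
    apply (is_derive_plus (V := X)); [exact (is_derive_const (V := X) (u 0) s) | ].
    apply (is_derive_RInt (V := X) w _ 0); [ | apply Cw].
    exists (mkposreal _ Rlt_0_1). intros y _. apply (RInt_correct (V := X)).
    apply (ex_RInt_continuous (V := X)). intros. apply Cw. }
  assert (CU : forall s, continuous U s).
  { intros s. apply (ex_derive_continuous (K := R_AbsRing) (V := X)). eexists. apply DU. }
  assert (EU : forall s, segment T s -> U s = u s).
  { intros s Hs. symmetry. now apply C1_RInt. }
  assert (Mu : forall s, 0 < s <= T ->
    is_RInt_gen (fun r => scal (k (s - r)) (u r)) (at_point 0) (at_left s)
      (scal C (RInt (fun y => U (s - Q y)) 0 (P s)))).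
  { intros s Hs. apply is_RInt_gen_memory_scal; [lra | exact Hk | ].
    apply is_RInt_gen_memory; [lra | exact CU | ].
    intros r Hr. apply EU. unfold segment. lra. }
  assert (Mdu : is_RInt_gen (fun r => scal (power_kernel beta (t - r)) (du r))
      (at_point 0) (at_left t) (RInt (fun y => w (t - Q y)) 0 (P t))).
  { apply is_RInt_gen_memory; [lra | exact Cw | ].
    intros r Hr. unfold w. rewrite clamp_id; [reflexivity | unfold segment; lra]. }
  split; [eexists; apply Mu, Ht | split; [eexists; exact Mdu | ]].
  apply (is_derive_within_of_is_derive _ (fun s => scal C (RInt (fun y => U (s - Q y)) 0 (P s)))).
  - unfold segment. lra.
  (* The radius [t] keeps s positive, as [Mu] requires. *)
  - exists (mkposreal t (proj1 Ht)). intros s Hs Ss.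
    change (Rabs (s - t) < t) in Hs. apply Rabs_lt_between in Hs.
    apply (is_RInt_gen_unique (V := X)), Mu. unfold segment in Ss. lra.
  - unfold memory. rewrite (is_RInt_gen_unique (V := X) _ _ Mdu).
    rewrite <- (EU 0) by (unfold segment; lra).
    assert (D := is_derive_RInt_delay U w P Q t (power_kernel beta t) DU Cw
      continuous_kernel_primitive_inv (is_derive_kernel_primitive t (proj1 Ht))
      (kernel_primitive_ge_0 t) (fun y => kernel_primitive_inv_range t y ltac:(lra))
      (kernel_primitive_inv_l t ltac:(lra))).
    apply (filterdiff_ext_lin (U := R_NormedModule) (V := X) _ (fun h : R => scal C (scal h
      (plus (RInt (fun y => w (t - Q y)) 0 (P t)) (scal (power_kernel beta t) (U 0)))))).
    + apply (filterdiff_scal_r_fct (V := X)); [exact Rmult_comm | exact D].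
    + intros h. etransitivity; [apply (scal_assoc (V := X)) | ].
      etransitivity; [ | symmetry; apply (scal_assoc (V := X))].
      apply (f_equal2 scal); [apply Rmult_comm | reflexivity].
Qed.

End Kernel.

(** * The constant of the bath power law *)

Lemma power_law_constant_unique (beta A B : R) (K k : R -> R) :
  (forall t, 0 < t -> k t = B * power_kernel beta t) ->
  is_equiv (Rbar_locally p_infty) K (fun t => A * power_kernel beta t) ->
  is_equiv (Rbar_locally p_infty) K k ->
  B = A.
Proof.
  intros Hk HA HB. apply NNPP. intros neq.
  (* With relative tolerance e = |B - A| / m, the two equivalences at a large t give |B - A| <= e
     (|A| + |B|) < |B - A|; the 1 in [m] makes the last inequality strict. *)
  set (m := Rabs A + Rabs B + 1).
  assert (m_pos : 0 < m).
  { assert (H1 := Rabs_pos A). assert (H2 := Rabs_pos B). unfold m. lra. }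
  assert (d_pos : 0 < Rabs (B - A)) by (apply Rabs_pos_lt; lra).
  assert (e_pos : 0 < Rabs (B - A) / m) by now apply Rdiv_lt_0_compat.
  destruct (HA (mkposreal _ e_pos)) as [M1 H1].
  destruct (HB (mkposreal _ e_pos)) as [M2 H2].
  (* Beyond both thresholds, and positive so that [Hk] applies. *)
  set (t := Rmax 0 (Rmax M1 M2) + 1).
  assert (H0 := Rmax_l 0 (Rmax M1 M2)). assert (H3 := Rmax_r 0 (Rmax M1 M2)).
  assert (H4 := Rmax_l M1 M2). assert (H5 := Rmax_r M1 M2).
  specialize (H1 t ltac:(unfold t; lra)). specialize (H2 t ltac:(unfold t; lra)).
  set (q := power_kernel beta t) in *.
  assert (q_pos : 0 < q) by apply Rpower_pos.
  change (Rabs (A * q - K t) <= Rabs (B - A) / m * Rabs (A * q)) in H1.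
  change (Rabs (k t - K t) <= Rabs (B - A) / m * Rabs (k t)) in H2.
  rewrite Hk in H2 by (unfold t; lra). fold q in H2.
  rewrite Rabs_mult, (Rabs_pos_eq q) in H1, H2 by lra.
  assert (H6 : Rabs (B - A) * q <= Rabs (B * q - K t) + Rabs (A * q - K t)).
  { rewrite <- (Rabs_pos_eq q) at 1 by lra. rewrite <- Rabs_mult.
    replace ((B - A) * q) with ((B * q - K t) - (A * q - K t)) by ring.
    unfold Rminus at 1. apply Rle_trans with (1 := Rabs_triang _ _). rewrite Rabs_Ropp. lra. }
  assert (H7 : Rabs (B - A) * q <= Rabs (B - A) * q * ((Rabs A + Rabs B) / m)).
  { apply Rle_trans with (1 := H6).
    replace (Rabs (B - A) * q * ((Rabs A + Rabs B) / m)) with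
      (Rabs (B - A) / m * (Rabs B * q) + Rabs (B - A) / m * (Rabs A * q)) by (field; lra).
    lra. }
  assert (H8 : (Rabs A + Rabs B) / m < 1).
  { apply Rmult_lt_reg_r with m; [lra | ]. unfold Rdiv.
    rewrite Rmult_assoc, Rinv_l by lra. unfold m. lra. }
  assert (H9 : 0 < Rabs (B - A) * q) by now apply Rmult_lt_0_compat.
  assert (H10 := Rmult_lt_compat_l _ _ _ H9 H8). lra.
Qed.

(** The angle PI beta / 2 lies in (0, PI/2), where the cosine is positive. *)
Lemma C_beta_neq_0 (c beta : R) : c <> 0 -> 0 < beta < 1 -> C_beta c beta <> 0.
Proof.
  intros Hc Hb. unfold C_beta. assert (HPI := PI_RGT_0).
  repeat apply Rmult_integral_contrapositive_currified; try lra.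
  - now apply Rinv_neq_0_compat, Rgt_not_eq.
  - apply Rgt_not_eq, Gamma_pos. lra.
  - apply Rgt_not_eq, cos_gt_0.
    + assert (0 < PI * beta) by (apply Rmult_lt_0_compat; lra). lra.
    + assert (PI * beta < PI * 1) by (apply Rmult_lt_compat_l; lra). lra.
Qed.

(** * Comparison with the Caputo derivative *)

Theorem theorem1p3 :
  forall (X : CompleteNormedModule R_AbsRing) (T : R) (u du : R -> X),
  0 < T -> is_C1 T u du ->
  forall beta : R, 0 < beta < 1 ->
  (forall t : R, 0 < t <= T ->
     ex_memory (power_kernel beta) u t /\
     ex_memory (power_kernel beta) du t /\
     exists d : X,
       is_derive_within (segment T) (memory (power_kernel beta) u) t d /\
       scal (/ Gamma (1 - beta)) d =
         plus (caputo beta du t)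
              (scal (Rpower t (- beta) / Gamma (1 - beta)) (u 0)))
  /\
  (forall (c : R) (J K k : R -> R),
     c <> 0 ->
     scale_free c beta J ->
     is_bath_kernel J K ->
     is_equiv (Rbar_locally p_infty) K
       (fun t => C_beta c beta * power_kernel beta t) ->
     is_power_law beta k ->
     is_equiv (Rbar_locally p_infty) K k ->
     u 0 = zero ->
     forall t : R, 0 < t <= T ->
       ex_memory k u t /\
       exists d : X,
         is_derive_within (segment T) (memory k u) t d /\
         scal (/ (C_beta c beta * Gamma (1 - beta))) d = caputo beta du t).
Proof.
  intros X T u du HT Hu beta Hbeta. split.
  - intros t Ht.
    destruct (memory_derivative beta Hbeta T 1 (power_kernel beta) u du t Hu Ht) as (Eu & Edu & D).
    { intros x _. ring. }
    split; [exact Eu | split; [exact Edu | ]].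
    eexists. split; [exact D | ].
    unfold caputo.
    rewrite (scal_one (V := X) _ : scal 1 _ = _).
    etransitivity; [apply (scal_distr_l (V := X)) | ].
    apply (f_equal2 plus); [reflexivity | ].
    etransitivity; [apply (scal_assoc (V := X)) | ].
    apply (f_equal2 scal); [apply Rmult_comm | reflexivity].
  - intros c J K k Hc _ _ HK [C Hk] HKk Hu0 t Ht.
    destruct (memory_derivative beta Hbeta T C k u du t Hu Ht Hk) as (Eu & _ & D).
    split; [exact Eu | ].
    eexists. split; [exact D | ].
    (* The constant of [k] is thus the one in the normalisation, and the two cancel; the boundary
       term vanishes with u 0. *)
    rewrite (power_law_constant_unique beta (C_beta c beta) C K k Hk HK HKk).
    unfold caputo. rewrite Hu0.
    etransitivity; [apply (scal_assoc (V := X)) | ].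
    apply (f_equal2 scal).
    + assert (H1 := C_beta_neq_0 c beta Hc Hbeta).
      assert (H2 := Gamma_pos (1 - beta) ltac:(lra)).
      change (/ (C_beta c beta * Gamma (1 - beta)) * C_beta c beta = / Gamma (1 - beta)).
      field. split; lra.
    + etransitivity; [ | apply (plus_zero_r (G := X))].
      apply (f_equal2 plus); [reflexivity | apply (scal_zero_r (V := X))].
Qed.
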